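(* Let $t\in\mathbb{N}=\{1,2,\dots\}$ be arbitrary and let $G=\mathcal{AT}((1+(k-1)t)_{k\ge1})$ be the infinite antitree with generations $V_k$, $|V_k|=1+(k-1)t$. Then the Ollivier-Ricci curvature with idleness $0$ of edges of $G$ is $$\kappa_0(x,y)=\begin{cases}\dfrac{t}{3t+2} & \text{for } x\in V_1,\ y\in V_2,\\[2mm] \dfrac{6t^2}{(3kt+2)(3kt+2-3t)} & \text{for } x\in V_k,\ y\in V_{k+1},\ k\ge2,\\[2mm] 1-\dfrac{1}{3kt+2-3t} & \text{for } x,y\in V_k,\ x\ne y,\ k\ge2.\end{cases}$$ In particular, $\kappa_0$ of radial edges (i.e. edges between $x\in V_k$ and $y\in V_{k+1}$) decays asymptotically like $\frac{2}{3k^2}$ as $k\to\infty$, i.e. $\kappa_0(x,y)\cdot\frac{3k^2}{2}\to1$ as $k\to\infty$.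
   Context: Antitree: for a sequence $(a_k)_{k\ge1}$ of positive integers, $\mathcal{AT}((a_k))$ is the simple graph whose vertex set is the disjoint union $V=\bigsqcup_{k\ge1}V_k$ of ''generations'' with $|V_k|=a_k$, where two distinct vertices $x\in V_k$, $y\in V_l$ are adjacent if and only if $|k-l|\le 1$ (so each generation induces a complete graph, consecutive generations are completely joined, and there are no other edges). Ollivier-Ricci curvature: let $d$ be the combinatorial distance and $d_x$ the degree of $x$. For $x\in V$ and $p\in[0,1]$ let $\mu_x^p$ be the probability measure on $V$ with $\mu_x^p(x)=p$, $\mu_x^p(z)=\frac{1-p}{d_x}$ for $z\sim x$, and $\mu_x^p(z)=0$ otherwise. The Wasserstein distance of two probability measures $\mu_1,\mu_2$ on $V$ is $W_1(\mu_1,\mu_2)=\inf_\pi\sum_{x,y\in V}d(x,y)\pi(x,y)$, the infimum running over all $\pi:V\times V\to[0,1]$ with $\mu_1(x)=\sum_y\pi(x,y)$ and $\mu_2(y)=\sum_x\pi(x,y)$. For an edge $x\sim y$, $\kappa_p(x,y)=1-W_1(\mu_x^p,\mu_y^p)$; here $p=0$. *)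

(* Defs.v *)
From HB Require Import structures.
From mathcomp Require Import all_boot all_order all_algebra finmap.
From mathcomp Require Import all_classical all_reals all_analysis.

Set Implicit Arguments.
Unset Strict Implicit.
Unset Printing Implicit Defensive.

Import Order.TTheory GRing.Theory Num.Theory.
Import numFieldNormedType.Exports.

Local Open Scope classical_set_scope.
Local Open Scope ring_scope.
Local Open Scope ereal_scope.

Section OllivierRicci.
Variables (R : realType) (V : choiceType) (adj : rel V).

(* Least length of a walk, +oo if there is none; [path adj x s] describes the
   walk x :: s, which has [size s] edges. *)
Definition graph_dist (x y : V) : \bar R :=
  ereal_inf [set (size s)%:R%:E | s in [set s | path adj x s /\ last x s = y]].

(* [fset_set] sends infinite sets to fset0, so this is the degree only in
   locally finite graphs. *)
Definition degree (x : V) : nat := #|` fset_set [set y | adj x y] |%fset.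

Definition lazy_walk (p : R) (x z : V) : R :=
  (if z == x then p else if adj x z then (1 - p) / (degree x)%:R else 0)%R.

Definition coupling (mu1 mu2 : V -> R) (pi : V -> V -> R) : Prop :=
  [/\ forall x y, (0 <= pi x y <= 1)%R,
      forall x, \esum_(y in [set: V]) (pi x y)%:E = (mu1 x)%:E &
      forall y, \esum_(x in [set: V]) (pi x y)%:E = (mu2 y)%:E].

Definition transport_cost (pi : V -> V -> R) : \bar R :=
  \esum_(z in [set: V * V]) (graph_dist z.1 z.2 * (pi z.1 z.2)%:E).

Definition wasserstein1 (mu1 mu2 : V -> R) : \bar R :=
  ereal_inf [set transport_cost pi | pi in coupling mu1 mu2].

Definition ollivier_ricci (p : R) (x y : V) : \bar R :=
  1 - wasserstein1 (lazy_walk p x) (lazy_walk p y).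

End OllivierRicci.

Section Antitree.
Variable a : nat -> nat.

(* Generations are numbered from 1 and [a 0] is irrelevant: a vertex with tag j
   lies in generation j + 1, which has [a j.+1] elements. *)
Definition antitree : Type := {j : nat & 'I_(a j.+1)}.

HB.instance Definition _ := Choice.on antitree.

Definition generation (x : antitree) : nat := (tag x).+1.

Definition antitree_adj : rel antitree :=
  fun x y => (x != y) && (`|generation x - generation y| <= 1)%N.

Lemma antitree_adj_irr : irreflexive antitree_adj.
Proof. by move=> x; rewrite /antitree_adj eqxx. Qed.

Lemma antitree_adj_sym : symmetric antitree_adj.
Proof. by move=> x y; rewrite /antitree_adj eq_sym distnC. Qed.

End Antitree.

Definition linear_growth (t k : nat) : nat := (1 + (k - 1) * t)%N.

(* Main.v *)
Require Import Defs.
From HB Require Import structures.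
From mathcomp Require Import all_boot all_order all_algebra finmap.
From mathcomp Require Import all_classical all_reals all_analysis.
From mathcomp Require Import ring lra zify.

Set Implicit Arguments.
Unset Strict Implicit.
Unset Printing Implicit Defensive.

Import Order.TTheory GRing.Theory Num.Theory.
Import numFieldNormedType.Exports.

Local Open Scope classical_set_scope.
Local Open Scope ring_scope.


(** The curvature of an edge is read off from a transport plan together with a
Kantorovich potential certifying that it is optimal.  Suppose [f] is
nonnegative and grows by at most 1 along each edge, so that
[f y - f x <= d(x, y)].  Then every coupling of [mu] and [nu] costs at least
[sum f nu - sum f mu], with equality when the coupling moves mass only between
vertices where [f y - f x = d(x, y)].  So [wasserstein1_tight] reduces each
curvature to a potential, a plan supported where it is tight, and two sums.

Plans are assembled from two pieces: leave a common part of the two measures in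
place ([tight_transport_stay]), and spread a measure [g] over a measure [h] of
the same mass by the product plan ([tight_transport_prod]); plans add up
([tight_transportD]).

Write D = 3(k-1)t+2 for the degree in generation V_k, k >= 2, and D' for the
degree in V_(k+1).  As the measures are uniform on spheres, only the sizes of
the generations matter.

- Radial edge, x in V_k, y in V_(k+1), k >= 2.  The potential is the generation
  number; all transport goes outwards along geodesics.  The vertices of
  V_k and V_(k+1) other than x and y keep 1/D', the mass 1/D' missing at x comes
  from V_(k-1), and all the rest goes to V_(k+2).  Comparing mean generations
  gives W = 1 + 2t/D' - 2t/D.
- Root edge, x in V_1, y in V_2.  There is no generation before V_1, so x has
  to be filled from V_2, against the previous potential.  The potential is
  now the indicator of the complement of V_2: all the moving mass leaves V_2,
  for x or V_3, at distance 1.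
- Edge inside V_k, k >= 2.  The two measures differ only by the mass 1/D,
  sitting at y for the first one and at x for the second one; the potential is
  the indicator of x and W = 1/D.

The decay rate then follows by writing the radial curvature times 3k^2/2 as
1 / ((1 + c/k)(1 + c'/k)). *)

(** * Nonnegative functions of finite total mass *)


Section Mass.
Variables (R : realType) (V : choiceType).
Implicit Types (g h : V -> R) (a b c : R).

Lemma ge0_esumZl (T : choiceType) c (F : T -> \bar R) : 0 <= c ->
  (forall z, 0 <= F z)%E ->
  (\esum_(z in [set: T]) (c%:E * F z) = c%:E * \esum_(z in [set: T]) F z)%E.
Proof.
have le_scale e (H : T -> \bar R) : 0 <= e -> (forall z, 0 <= H z)%E ->
    (\esum_(z in [set: T]) (e%:E * H z) <= e%:E * \esum_(z in [set: T]) H z)%E.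
  move=> e0 H0; apply: ge_ereal_sup => _ [A [finA AD] <-].
  rewrite -ge0_mule_fsumr//; apply: lee_wpmul2l; first by rewrite lee_fin.
  by apply: ereal_sup_ubound; exists A.
rewrite le_eqVlt => /orP[/eqP <- _|c_gt0 F0].
  by rewrite mul0e esum1// => z _; rewrite mul0e.
apply/eqP; rewrite eq_le; apply/andP; split.
  by apply: le_scale => //; exact: ltW.
have := le_scale c^-1 (fun z => c%:E * F z)%E _ _.
rewrite (@eq_esum _ _ _ _ F) => [le_cV|z _]; last first.
  by rewrite muleA -EFinM mulVf ?mul1e ?gt_eqF.
rewrite -lee_pdivlMl// le_cV ?invr_ge0 1?ltW// => z.
by rewrite mule_ge0 // lee_fin ltW.
Qed.

(** Finite measures are kept as real functions with a known sum, so that sums of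
combinations of indicators reduce to arithmetic in [R]. *)
Definition has_mass g a :=
  (forall z, 0 <= g z) /\ \esum_(z in [set: V]) (g z)%:E = a%:E.

Lemma has_mass_ext g h a : g =1 h -> has_mass g a -> has_mass h a.
Proof. by move=> /funext ->. Qed.

Lemma has_massD g h a b :
  has_mass g a -> has_mass h b -> has_mass (fun z => g z + h z) (a + b).
Proof.
move=> [g0 ga] [h0 hb]; split=> [z|]; first exact: addr_ge0.
by rewrite EFinD -ga -hb -esumD// => z _; rewrite lee_fin.
Qed.

Lemma has_massB g h a b : (forall z, h z <= g z) ->
  has_mass g a -> has_mass h b -> has_mass (fun z => g z - h z) (a - b).
Proof.
move=> le_hg [g0 ga] [h0 hb]; split=> [z|]; first by rewrite subr_ge0.
have gE : (\esum_(z in [set: V]) (g z)%:E =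
           \esum_(z in [set: V]) (g z - h z)%:E + b%:E)%E.
  rewrite -hb -esumD => [|z _|z _]; last 2 first.
  - by rewrite lee_fin subr_ge0.
  - by rewrite lee_fin.
  by apply: eq_esum => z _; rewrite -EFinD subrK.
by rewrite EFinB -ga gE addeK.
Qed.

Lemma has_massZ c g a :
  0 <= c -> has_mass g a -> has_mass (fun z => c * g z) (c * a).
Proof.
move=> c0 [g0 ga]; split=> [z|]; first exact: mulr_ge0.
by rewrite EFinM -ga -ge0_esumZl// => z; rewrite lee_fin.
Qed.

Lemma has_mass0 : has_mass (fun=> 0) 0.
Proof. by split=> //; rewrite esum1. Qed.

Lemma has_mass_at (v : V) g : 0 <= g v ->
  has_mass (fun z => if z == v then g z else 0) (g v).
Proof.
move=> g0; split=> [z|]; first by case: eqP => // ->.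
rewrite -(@esum_set1 _ _ v (fun z => (g z)%:E)) ?lee_fin//.
rewrite [RHS]esum_mkcond; apply: eq_esum => z _.
by case: eqP => [->|zv]; [rewrite mem_set|rewrite memNset].
Qed.

Lemma has_mass_ge g a z : has_mass g a -> g z <= a.
Proof.
move=> [g0 ga]; rewrite -lee_fin -ga.
rewrite -(@esum_set1 _ _ z (fun z => (g z)%:E)) ?lee_fin//.
rewrite [leLHS]esum_mkcond; apply: le_esum => w _.
by case: ifP => _; rewrite ?lee_fin.
Qed.

Lemma has_mass_uniq g a b : has_mass g a -> has_mass g b -> a = b.
Proof. by move=> [_ ga] [_]; rewrite ga => -[]. Qed.

End Mass.

(** * Transport plans certified by a potential *)

Section Transport.
Variables (R : realType) (V : choiceType) (adj : rel V).
Implicit Types (f g h mu nu : V -> R) (pi : V -> V -> R).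
Local Notation dist := (graph_dist R adj).

Lemma graph_dist_ge0 x y : (0 <= dist x y)%E.
Proof. by apply: le_ereal_inf_tmp => _ [s _ <-]; rewrite lee_fin. Qed.

Lemma graph_dist_walk x s : path adj x s ->
  (dist x (last x s) <= (size s)%:R%:E)%E.
Proof. by move=> xs; apply: ereal_inf_lbound; exists s. Qed.

Lemma graph_dist_refl x : (dist x x <= 0)%E.
Proof. exact: (@graph_dist_walk x [::]). Qed.

Lemma graph_dist_adj x y : adj x y -> (dist x y <= 1)%E.
Proof. by move=> xy; apply: (@graph_dist_walk x [:: y]); rewrite /= xy. Qed.

Definition edge_lipschitz f := forall x y, adj x y -> f y <= f x + 1.

(** The bound on edges adds up along walks, and the distance is the infimum of
the lengths of walks. *)
Lemma edge_lipschitz_dist f x y :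
  edge_lipschitz f -> ((f y)%:E <= dist x y + (f x)%:E)%E.
Proof.
move=> lip; rewrite -leeBlDr//; apply: le_ereal_inf_tmp => _ [s [xs <-] <-].
rewrite -EFinB lee_fin lerBlDr.
elim: s x xs => [|z s IHs] x /=; first by rewrite add0r.
move=> /andP[xz /IHs]/le_trans; apply.
by rewrite -natr1 -addrA lerD2l addrC lip.
Qed.

Definition has_marginals pi mu nu :=
  [/\ forall x y, 0 <= pi x y,
      forall x, \esum_(y in [set: V]) (pi x y)%:E = (mu x)%:E &
      forall y, \esum_(x in [set: V]) (pi x y)%:E = (nu y)%:E].

(** Integrating a function of the first coordinate against a plan only sees the
first marginal, by Tonelli's theorem. *)
Lemma esum_fst pi mu nu f a : (forall x, 0 <= f x) ->
  has_marginals pi mu nu -> has_mass (fun x => f x * mu x) a ->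
  (\esum_(z in [set: V * V]) ((f z.1)%:E * (pi z.1 z.2)%:E) = a%:E)%E.
Proof.
move=> f0 [pi0 row _] [_ <-].
rewrite (_ : [set: V * V] = [set: V] `*`` (fun=> setT)); last first.
  by apply/seteqP; split.
rewrite -(@esum_esum _ _ _ _ _ (fun x y => (f x)%:E * (pi x y)%:E)%E).
  apply: eq_esum => x _; rewrite ge0_esumZl ?row// => y.
  by rewrite lee_fin.
by move=> x y _ _; rewrite -EFinM lee_fin mulr_ge0.
Qed.

Lemma esum_snd pi mu nu f b : (forall x, 0 <= f x) ->
  has_marginals pi mu nu -> has_mass (fun x => f x * nu x) b ->
  (\esum_(z in [set: V * V]) ((f z.2)%:E * (pi z.1 z.2)%:E) = b%:E)%E.
Proof.
move=> f0 [pi0 row col] nub.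
rewrite (@reindex_esum _ _ _ setT setT (fun z : V * V => (z.2, z.1))); last first.
  split=> //; first by move=> [x y] [x' y'] _ _ [-> ->].
  by move=> [x y] _; exists (y, x).
by apply: (@esum_fst (fun x y => pi y x) nu mu).
Qed.

(** The inequality says that the pair is tight: for a Lipschitz [f] it is the
equality [f y - f x = d(x, y)], written without subtraction because the
distance is extended real. *)
Definition tight_transport f mu nu := exists2 pi, has_marginals pi mu nu &
  forall x y, pi x y != 0 -> (dist x y + (f x)%:E <= (f y)%:E)%E.

(** Complementary slackness.  Summing [f y <= d(x, y) + f x] against any coupling
gives [b <= cost + a]; for a tight plan the reverse inequality holds termwise.
Since [f >= 0], both sides are sums of nonnegative terms and no summability has
to be checked. *)
Lemma wasserstein1_tight f mu nu a b :
  (forall x, mu x <= 1) -> (forall x, 0 <= f x) -> edge_lipschitz f ->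
  has_mass (fun x => f x * mu x) a -> has_mass (fun x => f x * nu x) b ->
  tight_transport f mu nu -> wasserstein1 adj mu nu = (b - a)%:E.
Proof.
move=> mu1 f0 lip mua nub [pi0 marg0 tight].
have cost_split pi : has_marginals pi mu nu ->
    (\esum_(z in [set: V * V])
       ((dist z.1 z.2 + (f z.1)%:E) * (pi z.1 z.2)%:E) =
     transport_cost adj pi + a%:E)%E.
  move=> marg; rewrite -(esum_fst f0 marg mua) /transport_cost -esumD.
  - by apply: eq_esum => z _; rewrite ge0_muleDl ?graph_dist_ge0 ?lee_fin.
  - move=> z _; rewrite mule_ge0 ?graph_dist_ge0 ?lee_fin//.
    by case: marg.
  - move=> z _; rewrite mule_ge0 ?lee_fin//; by case: marg.
apply/eqP; rewrite eq_le; apply/andP; split; last first.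
  apply: le_ereal_inf_tmp => _ [pi [pi01 row col] <-].
  have marg : has_marginals pi mu nu by split=> // x y; case/andP: (pi01 x y).
  rewrite EFinB leeBlDr// -cost_split// -(esum_snd f0 marg nub).
  apply: le_esum => z _; apply: lee_wpmul2r; last exact: edge_lipschitz_dist.
  by case: marg => + _ _; rewrite lee_fin.
apply: (@le_trans _ _ (transport_cost adj pi0)).
  apply: ereal_inf_lbound; exists pi0 => //.
  have [pi_ge0 row col] := marg0; split=> // x y; rewrite pi_ge0/=.
  (* a coupling takes values in [0, 1]: each entry is at most its row sum *)
  apply: le_trans (mu1 x); apply: (@has_mass_ge _ _ (pi0 x)).
  by split.
rewrite EFinB leeBrDr// -cost_split// -(esum_snd f0 marg0 nub).
apply: le_esum => z _; have [->|nz] := eqVneq (pi0 z.1 z.2) 0.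
  by rewrite !mule0.
apply: lee_wpmul2r; last exact: tight.
by case: marg0 => + _ _; rewrite lee_fin.
Qed.

Lemma tight_transport_ext f mu nu mu' nu' : mu =1 mu' -> nu =1 nu' ->
  tight_transport f mu nu -> tight_transport f mu' nu'.
Proof. by move=> /funext -> /funext ->. Qed.

Lemma tight_transport_stay f g :
  (forall x, 0 <= g x) -> tight_transport f g g.
Proof.
move=> g0; exists (fun x y => if y == x then g y else 0).
  split=> [x y|x|y].
  - by case: ifP.
  - exact: (has_mass_at (g0 x)).2.
  - rewrite -(has_mass_at (g0 y)).2.
    by apply: eq_esum => x _; rewrite eq_sym; case: eqP => // ->.
move=> x y; have [-> _|_] := eqVneq y x; last by rewrite eqxx.
by rewrite -[leRHS]add0e leeD// graph_dist_refl.
Qed.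

(** The plan is [g x * h y / m].  When [m = 0] both measures vanish, so division
by zero does no harm. *)
Lemma tight_transport_prod f g h m :
  has_mass g m -> has_mass h m ->
  (forall x y, g x != 0 -> h y != 0 -> (dist x y + (f x)%:E <= (f y)%:E)%E) ->
  tight_transport f g h.
Proof.
move=> gm hm tight; have [g0 _] := gm; have [h0 _] := hm.
have scale u (u' : V -> R) : has_mass u' m -> 0 <= u <= m ->
    \esum_(y in [set: V]) (u / m * u' y)%:E = u%:E.
  move=> u'm /andP[u0 um].
  have [|_ ->] := @has_massZ _ _ (u / m) _ _ _ u'm.
    by rewrite divr_ge0// (le_trans u0).
  have [m0|m0] := eqVneq m 0; last by rewrite divfK.
  by move: um; rewrite m0 mulr0 => um; congr EFin; apply/le_anti/andP.
exists (fun x y => g x * h y / m).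
  split=> [x y|x|y].
  - rewrite divr_ge0 ?mulr_ge0//; exact: le_trans (g0 x) (has_mass_ge x gm).
  - rewrite -(scale (g x) h) ?g0 ?(has_mass_ge x gm)//.
    by apply: eq_esum => y _; congr EFin; ring.
  - rewrite -(scale (h y) g) ?h0 ?(has_mass_ge y hm)//.
    by apply: eq_esum => x _; congr EFin; ring.
move=> x y; have [->|gx] := eqVneq (g x) 0; first by rewrite !mul0r eqxx.
have [->|hy] := eqVneq (h y) 0; first by rewrite mulr0 mul0r eqxx.
by move=> _; exact: tight.
Qed.

Lemma tight_transportD f g h g' h' :
  tight_transport f g h -> tight_transport f g' h' ->
  tight_transport f (fun x => g x + g' x) (fun y => h y + h' y).
Proof.
move=> [pi [pi0 row col] tight] [pi' [pi'0 row' col'] tight'].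
exists (fun x y => pi x y + pi' x y).
  split=> [x y|x|y]; first exact: addr_ge0.
  - by rewrite EFinD -row -row' -esumD// => y _; rewrite lee_fin.
  - by rewrite EFinD -col -col' -esumD// => x _; rewrite lee_fin.
move=> x y; have [p0|/tight//] := eqVneq (pi x y) 0.
by rewrite p0 add0r; exact: tight'.
Qed.

End Transport.

(** * Random walks and curvature *)

Lemma has_mass_pred (R : realType) (V : choiceType) (P : pred V) :
  finite_set [set z | P z] ->
  has_mass (fun z => (P z)%:R : R) (#|` fset_set [set z | P z]|%fset)%:R.
Proof.
move=> fin; split=> [z|]; first exact: ler0n.
transitivity (\esum_(z in [set z | P z]) (1 : R)%:E).
  rewrite [RHS]esum_mkcond; apply: eq_esum => z _.
  by case: (boolP (P z)) => Pz; [rewrite mem_set|rewrite memNset//; apply/negP].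
rewrite esum_fset => [||z _]; [|by []|by rewrite lee_fin].
by rewrite fsbig_finite//= sumEFin card_fset_sum1 natr_sum.
Qed.

Lemma degreeE (R : realType) (V : choiceType) (adj : rel V) x (d : R) :
  finite_set [set y | adj x y] ->
  has_mass (fun y => (adj x y)%:R) d -> (degree adj x)%:R = d.
Proof. by move=> /(has_mass_pred R); exact: has_mass_uniq. Qed.

Lemma lazy_walk_le1 (R : realType) (V : choiceType) (adj : rel V) (p : R) x z :
  0 <= p <= 1 -> lazy_walk adj p x z <= 1.
Proof.
move=> /andP[p0 p1]; rewrite /lazy_walk; case: ifP => // _; case: ifP => // _.
case: (degree adj x) => [|d]; first by rewrite invr0 mulr0.
rewrite ler_pdivrMr ?ltr0n// mul1r (@le_trans _ _ 1) ?ler1n//; lra.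
Qed.

Lemma ollivier_ricci_tight (R : realType) (V : choiceType) (adj : rel V)
    (x y : V) (f : V -> R) (a b : R) :
  (forall z, 0 <= f z) -> edge_lipschitz adj f ->
  has_mass (fun z => f z * lazy_walk adj 0 x z) a ->
  has_mass (fun z => f z * lazy_walk adj 0 y z) b ->
  tight_transport adj f (lazy_walk adj 0 x) (lazy_walk adj 0 y) ->
  ollivier_ricci adj 0 x y = (1 - (b - a))%:E.
Proof.
move=> f0 lip mua nub tight; rewrite /ollivier_ricci.
rewrite (wasserstein1_tight _ f0 lip mua nub)// => z.
by rewrite lazy_walk_le1 ?lexx ?ler01.
Qed.

Lemma edge_lipschitz_unit (R : realType) (V : choiceType) (adj : rel V)
  (f : V -> R) : (forall z, 0 <= f z <= 1) -> edge_lipschitz adj f.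
Proof. by move=> f01 x y _; have := f01 x; have := f01 y; lra. Qed.

(** * Antitrees *)

Section AntitreeWalk.
Variables (R : realType) (a : nat -> nat).
Hypothesis a_gt0 : forall k, (0 < a k.+1)%N.
Local Notation V := (antitree a).
Local Notation adj := (@antitree_adj a).
Local Notation dist := (graph_dist R adj).

Definition layer (m : nat) (z : V) : R := (generation z == m)%:R.
Definition atom (x z : V) : R := (z == x)%:R.

Lemma layer_ge0 m z : 0 <= layer m z. Proof. exact: ler0n. Qed.
Lemma atom_ge0 x z : 0 <= atom x z. Proof. exact: ler0n. Qed.

Lemma layer_neq0 m z : layer m z != 0 -> generation z = m.
Proof. by rewrite pnatr_eq0 eqb0 negbK => /eqP. Qed.

Lemma atom_neq0 x z : atom x z != 0 -> z = x.
Proof. by rewrite pnatr_eq0 eqb0 negbK => /eqP. Qed.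

Lemma mul_generation_layer m z :
  (generation z)%:R * layer m z = m%:R * layer m z :> R.
Proof. by rewrite /layer; case: eqP => [->|]; rewrite ?mulr0. Qed.

Lemma mul_generation_atom x z :
  (generation z)%:R * atom x z = (generation x)%:R * atom x z :> R.
Proof. by rewrite /atom; case: eqP => [->|]; rewrite ?mulr0. Qed.

Lemma mul_layer m m' z : layer m z * layer m' z = (m == m')%:R * layer m' z.
Proof.
rewrite /layer; have [->|_] := eqVneq (generation z) m'; last by rewrite !mulr0.
by rewrite eq_sym mulr1.
Qed.

Lemma mul_atom m x z : generation x = m -> layer m z * atom x z = atom x z.
Proof.
rewrite /layer /atom => xm; have [->|_] := eqVneq z x; last by rewrite mulr0.
by rewrite xm eqxx mul1r.
Qed.

Lemma atom_le_layer m x z : generation x = m -> atom x z <= layer m z.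
Proof.
move=> xm; rewrite /atom; have [->|_] := eqVneq z x; last exact: layer_ge0.
by rewrite /layer xm eqxx.
Qed.

Lemma layerE m : [set z : V | generation z == m.+1] =
  (fun i : 'I_(a m.+1) => Tagged (fun j => 'I_(a j.+1)) i) @` setT.
Proof.
apply/seteqP; split=> [[j i]|z [i _ <-]]; rewrite /= /generation//=.
by move=> /eqP[jm]; case: _ / jm; exists i.
Qed.

Lemma finite_layer m : finite_set [set z : V | generation z == m].
Proof.
case: m => [|m]; first by rewrite (_ : mkset _ = set0)//; apply/seteqP; split.
by rewrite layerE; apply: finite_image; exact: finite_finset.
Qed.

Lemma has_mass_layer m : has_mass (layer m.+1) (a m.+1)%:R.
Proof.
rewrite -[X in X%:R](_ : #|` fset_set [set z : V | generation z == m.+1]|%fset = _).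
  exact: has_mass_pred (finite_layer _).
apply: card_fset_set; rewrite layerE.
have := @card_II (a m.+1); rewrite card_eq_sym; apply: card_eq_trans.
by apply: inj_card_eq => i j _ _ /eqP; rewrite eq_Tagged => /eqP.
Qed.

Lemma has_mass_layer0 : has_mass (layer 0) 0.
Proof. by apply: (has_mass_ext _ (has_mass0 _ _)). Qed.

Lemma has_mass_atom x : has_mass (atom x) 1.
Proof.
apply: (has_mass_ext _ (@has_mass_at R V x (fun=> 1) ler01)) => z.
by rewrite /atom; case: eqP.
Qed.

(** A generation with one of its vertices removed. *)
Lemma has_mass_layerB m x : generation x = m.+1 ->
  has_mass (fun z => layer m.+1 z - atom x z) ((a m.+1)%:R - 1).
Proof.
move=> xm; apply: has_massB (has_mass_layer m) (has_mass_atom x) => z.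
exact: atom_le_layer.
Qed.

Lemma antitree_adjE x y k : generation x = k.+1 ->
  (adj x y)%:R = layer k y + layer k.+1 y + layer k.+2 y - atom x y.
Proof.
rewrite /antitree_adj /layer /atom => xk; rewrite {1}xk.
have [->|yx] /= := eqVneq y x.
  rewrite xk eqxx.
  have [-> ->] : (k.+1 == k) = false /\ (k.+1 == k.+2) = false by lia.
  by rewrite /=; ring.
move: (generation y) => n; rewrite subr0.
have -> : (`|k.+1 - n| <= 1)%N = [|| n == k, n == k.+1 | n == k.+2] by lia.
case: (eqVneq n k) => nk; case: (eqVneq n k.+1) => nk1;
  case: (eqVneq n k.+2) => nk2;
  by [lia|rewrite /= ?addr0 ?add0r].
Qed.

Lemma finite_antitree_adj x : finite_set [set y : V | adj x y].
Proof.
have [k xk] : exists k, generation x = k.+1 by exists (tag x).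
apply: (@sub_finite_set _ _ ([set y : V | generation y == k] `|`
  [set y : V | generation y == k.+1] `|` [set y : V | generation y == k.+2])).
  move=> y; rewrite /= /antitree_adj xk => /andP[_ dist_le1].
  have [->|yk] := eqVneq (generation y) k; first by left; left.
  have [->|yk1] := eqVneq (generation y) k.+1; first by left; right.
  by right; lia.
by rewrite !finite_setU; do !split; exact: finite_layer.
Qed.

(** The size [b] of the preceding generation is a parameter because generation 0,
which precedes the root, is empty whatever the value of [a 0]. *)
Lemma has_mass_antitree_adj x k b : generation x = k.+1 ->
  has_mass (layer k) b ->
  has_mass (fun y => (adj x y)%:R) (b + (a k.+1)%:R + (a k.+2)%:R - 1 : R).
Proof.
move=> xk kb; apply: (has_mass_ext (fun y => esym (antitree_adjE y xk))).
apply: has_massB (has_mass_atom x) => [y|].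
  by rewrite -subr_ge0 -(antitree_adjE y xk).
by apply: has_massD (has_mass_layer _); apply: has_massD (has_mass_layer _).
Qed.

Lemma lazy_walk0E x k b z : generation x = k.+1 -> has_mass (layer k) b ->
  lazy_walk adj 0 x z = (layer k z + layer k.+1 z + layer k.+2 z - atom x z)
    / (b + (a k.+1)%:R + (a k.+2)%:R - 1).
Proof.
move=> xk kb; rewrite -(antitree_adjE z xk) /lazy_walk.
rewrite -(degreeE (finite_antitree_adj x) (has_mass_antitree_adj xk kb)).
have [->|zx] := eqVneq z x; first by rewrite antitree_adj_irr mul0r.
by case: ifP => _; rewrite ?subr0 ?mul0r.
Qed.

(** A geodesic climbs one generation at a time; it exists because no generation
is empty. *)
Lemma graph_dist_antitree x y : (generation x < generation y)%N ->
  (dist x y <= (generation y - generation x)%:R%:E)%E.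
Proof.
move=> xy; have [n ny] : exists n, generation y = (n + (generation x).+1)%N.
  by exists (generation y - (generation x).+1)%N; lia.
suff [s [xs sy sn]] : exists s, [/\ path adj x s, last x s = y & size s = n.+1].
  rewrite -{1}sy; apply: le_trans (graph_dist_walk R xs) _.
  by rewrite lee_fin ler_nat sn; lia.
elim: n x ny {xy} => [|n IHn] x ny.
  exists [:: y]; split=> //; rewrite /= andbT /antitree_adj; apply/andP; split.
    by apply/eqP => xy; move: ny; rewrite xy; lia.
  by lia.
pose z : V := Tagged (fun j => 'I_(a j.+1)) (Ordinal (a_gt0 (generation x))).
have zE : generation z = (generation x).+1 by [].
have [|s [zs sy sn]] := IHn z; first by rewrite zE ny; lia.
exists (z :: s); split=> //=; last by rewrite sn.
rewrite zs andbT /antitree_adj; apply/andP; split.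
  by apply/eqP => xz; move: zE; rewrite -xz; lia.
by rewrite zE; lia.
Qed.

Lemma edge_lipschitz_generation :
  edge_lipschitz adj (fun z => (generation z)%:R : R).
Proof. by move=> x y /andP[_ xy]; rewrite natr1 ler_nat; lia. Qed.

End AntitreeWalk.

(** * Generations growing linearly *)

Section LinearGrowth.
Variables (R : realType) (t : nat).
Local Notation a := (linear_growth t).
Local Notation V := (antitree a).
Local Notation adj := (@antitree_adj a).
Local Notation layer := (@layer R a).
Local Notation atom := (@atom R a).
Local Notation tR := (t%:R : R).
Implicit Types x y z : V.

Lemma linear_growth_gt0 k : (0 < a k.+1)%N.
Proof. by []. Qed.

Lemma linear_growthE k : (a k.+1)%:R = 1 + k%:R * tR.
Proof. by rewrite /linear_growth subn1/= natrD natrM. Qed.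

(** The degree of the vertices of generation [k.+1], for [k >= 1].  In generation
1 the degree is [1 + t] and not the value 2 of this formula, as one of the
three surrounding generations is missing. *)
Definition walk_degree (k : nat) : R := 3 * k%:R * tR + 2.

Lemma walk_degree_gt0 k : 0 < walk_degree k.
Proof. by rewrite /walk_degree ltr_wpDl// !mulr_ge0. Qed.

Lemma lazy_walk_linearE x k z : generation x = k.+2 ->
  lazy_walk adj 0 x z = (walk_degree k.+1)^-1 *
    (layer k.+1 z + layer k.+2 z + layer k.+3 z - atom x z).
Proof.
move=> xk; rewrite (lazy_walk0E z xk (has_mass_layer _ _ _)) mulrC.
congr (_^-1 * _).
by rewrite !linear_growthE /walk_degree -!natr1; ring.
Qed.

(** With the generation number as potential, any plan moving mass outwards along
geodesics is optimal, so it suffices to find one.  Besides the mass that stays,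
[fill] goes from the generation before [x] to [x], and [rise] is everything that
goes to the generation beyond [y].  All sizes are expressed by the size [n] of
the generation before [x]. *)
Lemma curvature_radial k x y : generation x = k.+2 -> generation y = k.+3 ->
  ollivier_ricci adj (0 : R) x y =
    (6 * tR ^+ 2 / (walk_degree k.+2 * walk_degree k.+1))%:E.
Proof.
move=> xk yk.
have D0 := walk_degree_gt0 k.+1; have D'0 := walk_degree_gt0 k.+2.
set D := walk_degree k.+1 in D0 *; set D' := walk_degree k.+2 in D'0 *.
pose n : R := 1 + k%:R * tR.
have n1 : 1 <= n by rewrite lerDl mulr_ge0.
have t0 : 0 <= tR by [].
have DE : D = 3 * n + 3 * tR - 1 by rewrite /D /walk_degree /n -!natr1; ring.
have D'E : D' = 3 * n + 6 * tR - 1 by rewrite /D' /walk_degree /n -!natr1; ring.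
have n2E : (a k.+2)%:R = n + tR by rewrite linear_growthE /n -!natr1; ring.
have n3E : (a k.+3)%:R = n + 2 * tR by rewrite linear_growthE /n -!natr1; ring.
have n4E : (a k.+4)%:R = n + 3 * tR by rewrite linear_growthE /n -!natr1; ring.
have l1 := @has_mass_layer R a k; rewrite linear_growthE -/n in l1.
have l2x := @has_mass_layerB R a _ _ xk; rewrite n2E in l2x.
have l3 := @has_mass_layer R a k.+2; rewrite n3E in l3.
have l3y := @has_mass_layerB R a _ _ yk; rewrite n3E in l3y.
have l2 := @has_mass_layer R a k.+1; rewrite n2E in l2.
have l4 := @has_mass_layer R a k.+3; rewrite n4E in l4.
have c0 : 0 <= D^-1 by rewrite invr_ge0 ltW.
have c'0 : 0 <= D'^-1 by rewrite invr_ge0 ltW.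
have le_c : D'^-1 <= D^-1 by rewrite lef_pV2 ?posrE// DE D'E; lra.
(* each vertex before x has enough mass for its share in filling x *)
have le_cn : D'^-1 / n <= D^-1.
  apply: le_trans le_c; rewrite ler_pdivrMr; last lra.
  by rewrite ler_peMr.
have mux : has_mass (fun z => (generation z)%:R * lazy_walk adj 0 x z)
    (D^-1 * (k.+1%:R * n + k.+2%:R * (n + tR - 1) + k.+3%:R * (n + 2 * tR))).
  have H := has_massZ c0 (has_massD (has_massD (has_massZ (ler0n _ k.+1) l1)
     (has_massZ (ler0n _ k.+2) l2x)) (has_massZ (ler0n _ k.+3) l3)).
  apply: has_mass_ext H => z; rewrite (lazy_walk_linearE z xk) -/D.
  by rewrite mulrCA !mulrBr !mulrDr !mul_generation_layer mul_generation_atom xk; ring.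
have muy : has_mass (fun z => (generation z)%:R * lazy_walk adj 0 y z)
    (D'^-1 * (k.+2%:R * (n + tR) + k.+3%:R * (n + 2 * tR - 1) +
              k.+4%:R * (n + 3 * tR))).
  have H := has_massZ c'0 (has_massD (has_massD (has_massZ (ler0n _ k.+2) l2)
     (has_massZ (ler0n _ k.+3) l3y)) (has_massZ (ler0n _ k.+4) l4)).
  apply: has_mass_ext H => z; rewrite (lazy_walk_linearE z yk) -/D'.
  by rewrite mulrCA !mulrBr !mulrDr !mul_generation_layer mul_generation_atom yk; ring.
have := ollivier_ricci_tight _ (@edge_lipschitz_generation R a) mux muy.
move=> ->//; last first.
  have stay := has_massZ c'0 (has_massD l2x l3y).
  have fill : has_mass (fun z => D'^-1 / n * layer k.+1 z) D'^-1.
    rewrite -[X in has_mass _ X](_ : D'^-1 / n * n = _).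
      by apply: has_massZ l1; rewrite divr_ge0//; lra.
    by rewrite divfK// gt_eqF//; lra.
  have x_mass : has_mass (fun z => D'^-1 * atom x z) D'^-1.
    by rewrite -[X in has_mass _ X]mulr1; apply: has_massZ (has_mass_atom _ _).
  have rise : has_mass (fun z => (D^-1 - D'^-1 / n) * layer k.+1 z +
      ((D^-1 - D'^-1) * (layer k.+2 z - atom x z + (layer k.+3 z - atom y z)) +
       D^-1 * atom y z)) (D'^-1 * (n + 3 * tR)).
    rewrite -[X in has_mass _ X](_ : (D^-1 - D'^-1 / n) * n +
      ((D^-1 - D'^-1) * (n + tR - 1 + (n + 2 * tR - 1)) + D^-1 * 1) = _).
      apply: has_massD; last apply: has_massD.
      - by apply: has_massZ l1; rewrite subr_ge0.
      - by apply: has_massZ (has_massD l2x l3y); rewrite subr_ge0.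
      - exact: has_massZ (has_mass_atom _ _).
    by rewrite DE D'E; field; rewrite ?gt_eqF//; lra.
  apply: (tight_transport_ext _ _ (tight_transportD
    (tight_transport_stay _ _ (proj1 stay))
    (tight_transportD (tight_transport_prod fill x_mass _)
                      (tight_transport_prod rise (has_massZ c'0 l4) _)))).
  - by move=> z; rewrite (lazy_walk_linearE z xk) -/D; ring.
  - by move=> z; rewrite (lazy_walk_linearE z yk) -/D'; ring.
  - move=> z w; rewrite !mulf_eq0 !negb_or.
    move=> /andP[_ /layer_neq0 zk] /andP[_ /atom_neq0 ->].
    have := @graph_dist_antitree R a linear_growth_gt0 z x.
    rewrite xk zk => /(_ (leqnn _)) le1; apply: le_trans (leeD2r _ le1) _.
    by rewrite -EFinD lee_fin -natrD ler_nat subSnn.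
  - move=> z w zn0; rewrite mulf_eq0 negb_or => /andP[_ /layer_neq0 wk].
    have zw : (generation z < generation w)%N.
      rewrite wk ltnNge; apply/negP => zk; move: zn0.
      rewrite /layer /atom.
      have -> : (generation z == k.+1) = false by lia.
      have -> : (generation z == k.+2) = false by lia.
      have -> : (generation z == k.+3) = false by lia.
      have -> : (z == x) = false by apply/eqP => zx; move: zk; rewrite zx xk; lia.
      have -> : (z == y) = false by apply/eqP => zx; move: zk; rewrite zx yk; lia.
      by rewrite !(mulr0,addr0,subr0) eqxx.
    apply: le_trans (leeD2r _ (graph_dist_antitree _ linear_growth_gt0 zw)) _.
    by rewrite -EFinD lee_fin -natrD ler_nat subnK// ltnW.
congr EFin; rewrite DE D'E -!natr1; field.
by rewrite !gt_eqF//; lra.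
Qed.

(** The mass that x receives from V_2 travels inwards, so the generation number is
not tight here; the indicator of the complement of V_2 is tight both for this
move and for the one from V_2 to V_3. *)
Lemma curvature_root x y : generation x = 1%N -> generation y = 2%N ->
  ollivier_ricci adj (0 : R) x y = (tR / (3 * tR + 2))%:E.
Proof.
move=> x1 y2.
pose D : R := 1 + tR; pose D' : R := 3 * tR + 2.
have t0 : 0 <= tR by [].
have D0 : 0 < D by rewrite /D; lra.
have D'0 : 0 < D' by rewrite /D'; lra.
have c0 : 0 <= D^-1 by rewrite invr_ge0 ltW.
have c'0 : 0 <= D'^-1 by rewrite invr_ge0 ltW.
have le_c : D'^-1 <= D^-1 by rewrite lef_pV2 ?posrE// /D /D'; lra.
(* the root generation has a single vertex: the difference has mass 0 *)
have l1 z : layer 1 z = atom x z.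
  have := @has_mass_layerB R a 0 x x1; rewrite subrr => B0.
  by apply/eqP; rewrite eq_le -subr_le0 (has_mass_ge z B0) atom_le_layer.
have l2 := @has_mass_layer R a 1; rewrite linear_growthE mul1r in l2.
have l3 := @has_mass_layer R a 2; rewrite linear_growthE in l3.
have l2y := @has_mass_layerB R a _ _ y2; rewrite linear_growthE mul1r in l2y.
have atomx := has_mass_atom R x.
have muE z : lazy_walk adj 0 x z = D^-1 * layer 2 z.
  rewrite (lazy_walk0E z x1 (has_mass_layer0 R a)) l1 mulrC.
  rewrite !linear_growthE mul0r mul1r.
  rewrite (_ : layer 0 z = 0)//; congr (_^-1 * _); rewrite /D; ring.
have nuE z : lazy_walk adj 0 y z =
    D'^-1 * (atom x z + (layer 2 z - atom y z) + layer 3 z).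
  rewrite (lazy_walk0E z y2 (has_mass_layer R a 0)) l1 mulrC.
  rewrite !linear_growthE mul0r mul1r.
  congr (_^-1 * _); rewrite /D'; ring.
pose f z : R := 1 - layer 2 z.
have f01 z : 0 <= f z <= 1 by rewrite /f /layer; case: eqP => _ /=; lra.
have fl2 z : f z * layer 2 z = 0 by rewrite /f mulrBl mul_layer /=; ring.
have fl3 z : f z * layer 3 z = layer 3 z by rewrite /f mulrBl mul_layer /=; ring.
have fx z : f z * atom x z = atom x z by rewrite -l1 /f mulrBl mul_layer /=; ring.
have fy z : f z * atom y z = 0 by rewrite /f mulrBl (mul_atom R z y2) mul1r subrr.
have leave : has_mass (fun z =>
      (D^-1 - D'^-1) * (layer 2 z - atom y z) + D^-1 * atom y z)
    (D'^-1 * (2 + 2 * tR)).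
  rewrite -[X in has_mass _ X](_ : (D^-1 - D'^-1) * (1 + tR - 1) + D^-1 * 1 = _).
    apply: has_massD; first by apply: has_massZ l2y; rewrite subr_ge0.
    exact: has_massZ (has_mass_atom _ _).
  by rewrite /D /D'; field; rewrite !gt_eqF.
have enter : has_mass (fun z => D'^-1 * (atom x z + layer 3 z)) (D'^-1 * (2 + 2 * tR)).
  rewrite -[X in has_mass _ X](_ : D'^-1 * (1 + (1 + 2 * tR)) = _).
    exact: has_massZ (has_massD atomx l3).
  by congr (_ * _); ring.
have mux : has_mass (fun z => f z * lazy_walk adj 0 x z) 0.
  by apply: has_mass_ext (has_mass0 _ _) => z; rewrite muE mulrCA fl2 mulr0.
have nuy : has_mass (fun z => f z * lazy_walk adj 0 y z) (D'^-1 * (2 + 2 * tR)).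
  apply: has_mass_ext enter => z; rewrite nuE.
  by rewrite [RHS]mulrCA !mulrDr mulrN fl2 fl3 fx fy; ring.
have f_ge0 z : 0 <= f z by case/andP: (f01 z).
have stay := has_massZ c'0 l2y.
rewrite (ollivier_ricci_tight f_ge0 (edge_lipschitz_unit f01) mux nuy).
  by congr EFin; rewrite /D'; field; rewrite gt_eqF.
apply: (tight_transport_ext _ _ (tight_transportD
   (tight_transport_stay _ _ (proj1 stay))
   (tight_transport_prod leave enter _))).
- by move=> z; rewrite muE; ring.
- by move=> z; rewrite nuE; ring.
move=> z w zn0; rewrite mulf_eq0 negb_or => /andP[_ wn0].
have z2 : generation z = 2%N.
  apply/eqP; apply: contraNT zn0 => z2; rewrite /layer /atom (negbTE z2).
  rewrite (_ : (z == y) = false) ?subrr ?mulr0 ?addr0//.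
  by apply/eqP => zy; move: z2; rewrite zy y2.
have w13 : generation w = 1%N \/ generation w = 3.
  have [x0|/atom_neq0 ->] := eqVneq (atom x w) 0; last by left.
  by right; move: wn0; rewrite x0 add0r => /layer_neq0.
rewrite /f /layer z2 subrr adde0.
rewrite (_ : (generation w == 2%N) = false) ?subr0; last by case: w13 => ->.
apply: graph_dist_adj; rewrite /antitree_adj z2; apply/andP; split.
  by apply/eqP => zw; move: w13; rewrite -zw z2; lia.
by case: w13 => ->.
Qed.

(** The neighbours of x and of y differ only by x and y themselves, so the optimal
plan moves one atom, from y to x. *)
Lemma curvature_spherical k x y :
  generation x = k.+2 -> generation y = k.+2 -> x != y ->
  ollivier_ricci adj (0 : R) x y = (1 - 1 / walk_degree k.+1)%:E.
Proof.
move=> xk yk xy.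
have D0 := walk_degree_gt0 k.+1; set D := walk_degree k.+1 in D0 *.
have c0 : 0 <= D^-1 by rewrite invr_ge0 ltW.
have atomx := has_mass_atom R x; have atomy := has_mass_atom R y.
have xx z : atom x z * atom x z = atom x z.
  by rewrite /atom; case: eqP; rewrite ?mulr0 ?mulr1.
have xy0 z : atom x z * atom y z = 0.
  rewrite /atom; have [->|] := eqVneq z x; last by rewrite mul0r.
  by rewrite (negbTE xy) mulr0.
have xl m z : atom x z * layer m z = (m == k.+2)%:R * atom x z.
  rewrite /atom /layer; have [->|_] := eqVneq z x; last by rewrite mul0r mulr0.
  by rewrite xk eq_sym mul1r mulr1.
have mux : has_mass (fun z => atom x z * lazy_walk adj 0 x z) 0.
  apply: has_mass_ext (has_mass0 _ _) => z; rewrite (lazy_walk_linearE z xk).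
  rewrite [RHS]mulrCA !mulrDr mulrN !xl xx eqxx.
  have -> : (k.+1 == k.+2) = false by lia.
  have -> : (k.+3 == k.+2) = false by lia.
  by rewrite /=; ring.
have muy : has_mass (fun z => atom x z * lazy_walk adj 0 y z) D^-1.
  have := has_massZ c0 atomx; rewrite mulr1.
  apply: has_mass_ext => z; rewrite (lazy_walk_linearE z yk).
  rewrite [RHS]mulrCA !mulrDr mulrN !xl xy0 eqxx.
  have -> : (k.+1 == k.+2) = false by lia.
  have -> : (k.+3 == k.+2) = false by lia.
  by rewrite /=; ring.
have x01 z : 0 <= atom x z <= 1 by rewrite /atom; case: eqP => _ /=; lra.
rewrite (ollivier_ricci_tight (@atom_ge0 R a x) (edge_lipschitz_unit x01) mux muy).
  by congr EFin; ring.
have stay z : 0 <=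
    D^-1 * (layer k.+1 z + (layer k.+2 z - (atom x z + atom y z)) + layer k.+3 z).
  rewrite mulr_ge0// addr_ge0 ?layer_ge0// addr_ge0 ?layer_ge0// subr_ge0 /layer /atom.
  have [->|zx] := eqVneq z x; first by rewrite (negbTE xy) xk eqxx addr0.
  have [->|zy] := eqVneq z y; first by rewrite yk eqxx add0r.
  by rewrite addr0.
apply: (tight_transport_ext _ _ (tight_transportD (tight_transport_stay _ _ stay)
   (tight_transport_prod (has_massZ c0 atomy) (has_massZ c0 atomx) _))).
- by move=> z; rewrite (lazy_walk_linearE z xk) -/D; ring.
- by move=> z; rewrite (lazy_walk_linearE z yk) -/D; ring.
move=> z w; rewrite !mulf_eq0 !negb_or => /andP[_ /atom_neq0 ->] /andP[_ /atom_neq0 ->].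
rewrite /atom eqxx eq_sym (negbTE xy) adde0.
by apply: graph_dist_adj; rewrite /antitree_adj eq_sym xy xk yk distnn.
Qed.

End LinearGrowth.

(** * Asymptotics *)

Lemma cvg_radial_decay (R : realType) (t : R) : 0 < t ->
  (6 * t ^+ 2 / ((3 * k%:R * t + 2) * (3 * k%:R * t + 2 - 3 * t)) *
    (3 * k%:R ^+ 2 / 2)) @[k --> \oo] --> (1 : R).
Proof.
move=> t0.
pose u (k : nat) : R := k.+1%:R^-1.
have u0 : u k @[k --> \oo] --> (0 : R) by exact: cvg_harmonic.
(* after the shift, u k is the inverse of the index and the formula is a
   product of inverses of affine functions of it *)
rewrite -cvg_shiftS.
have affine (c : R) : (1 + c * u k)^-1 @[k --> \oo] --> (1 : R).
  have lim1 : 1 + c * u k @[k --> \oo] --> (1 + c * 0 : R).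
    by apply: cvgD; [exact: cvg_cst|apply: cvgM => //; exact: cvg_cst].
  rewrite mulr0 addr0 in lim1.
  by have := cvgV (oner_neq0 R) lim1; rewrite invr1; apply.
rewrite [X in X @ _](_ : _ =
    (fun k => (1 + (2 / (3 * t)) * u k)^-1 * (1 + (2 / (3 * t) - 1) * u k)^-1)).
  have := cvgM (affine (2 / (3 * t))) (affine (2 / (3 * t) - 1)).
  by rewrite mulr1; apply.
apply/funext => k; rewrite /u /= -natr1.
have k0 : 0 <= k%:R :> R by [].
have kt0 : 0 <= k%:R * t by rewrite mulr_ge0// ltW.
by field; rewrite !gt_eqF//; lra.
Qed.

Theorem corollary1p7 (R : realType) (t : nat) (t_gt0 : (0 < t)%N) :
  let G := antitree (linear_growth t) in
  let kappa0 (x y : G) : \bar R := ollivier_ricci (@antitree_adj _) (0 : R) x y in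
  [/\ forall x y : G, generation x = 1%N -> generation y = 2%N ->
        kappa0 x y = (t%:R / (3 * t%:R + 2))%:E,
      forall (k : nat) (x y : G), (2 <= k)%N ->
        generation x = k -> generation y = k.+1 ->
        kappa0 x y =
          (6 * t%:R ^+ 2 / ((3 * k%:R * t%:R + 2)
                            * (3 * k%:R * t%:R + 2 - 3 * t%:R)))%:E,
      forall (k : nat) (x y : G), (2 <= k)%N ->
        generation x = k -> generation y = k -> x != y ->
        kappa0 x y = (1 - 1 / (3 * k%:R * t%:R + 2 - 3 * t%:R))%:E &
      forall x y : nat -> G,
        (forall k, (1 <= k)%N ->
           generation (x k) = k /\ generation (y k) = k.+1) ->
        (kappa0 (x k) (y k) * (3 * k%:R ^+ 2 / 2)%:E)%E @[k --> \oo]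
          --> (1%:E : \bar R)].
Proof.
move=> G kappa0.
have degree_pred k : walk_degree R t k.+1 =
    3 * k.+2%:R * t%:R + 2 - 3 * t%:R by rewrite /walk_degree -!natr1; ring.
have radial (k : nat) (x y : G) : (2 <= k)%N ->
    generation x = k -> generation y = k.+1 ->
    kappa0 x y = (6 * t%:R ^+ 2 / ((3 * k%:R * t%:R + 2)
                            * (3 * k%:R * t%:R + 2 - 3 * t%:R)))%:E.
  case: k => [|[|k]]// _ xk yk; rewrite /kappa0 (curvature_radial R xk yk).
  by rewrite (degree_pred k).
split=> //.
- by move=> x y; apply: curvature_root.
- case=> [|[|k]]// x y _ xk yk xy.
  by rewrite /kappa0 (curvature_spherical R xk yk xy) degree_pred.
- move=> x y xy.
  have t0 : 0 < t%:R :> R by rewrite ltr0n.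
  apply: cvg_EFin.
    near=> k; have k2 : (2 <= k)%N by near: k; exact: nbhs_infty_ge.
    by have [xk yk] := xy k (ltnW k2); rewrite (radial k _ _ k2 xk yk).
  apply: cvg_trans (cvg_radial_decay t0); apply: near_eq_cvg.
  near=> k; have k2 : (2 <= k)%N by near: k; exact: nbhs_infty_ge.
  by have [xk yk] := xy k (ltnW k2); rewrite /= (radial k _ _ k2 xk yk).
Unshelve. all: by end_near.
Qed.
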